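(* Let $f:\{0,1,2,\dots\}\to[0,\infty)$ be a non-decreasing function with $f(0)=0<f(1)$ and $\bar\theta>0$ (the jump rate of an attractive zero range process), and let $\mathcal{H}$ be the associated hydrodynamic flux function. If $f$ is convex, then $\mathcal{H}$ is convex; if $f$ is concave, then $\mathcal{H}$ is concave. Moreover, if $f$ is convex, then $\mathcal{H}$ is strictly convex if and only if $f$ is not linear; and if $f$ is concave, then $\mathcal{H}$ is strictly concave if and only if $f$ is not linear.
   Context: Set $f(0)!:=1$ and $f(x)!:=\prod_{y=1}^{x}f(y)$ for integers $x>0$. Let $\bar\theta:=\log\bigl(\liminf_{x\to\infty}(f(x)!)^{1/x}\bigr)\in[-\infty,\infty]$. For $\theta<\bar\theta$ define the probability measure $\mu^\theta$ on $\{0,1,2,\dots\}$ by $$\mu^\theta(x):=\frac{e^{\theta x}/f(x)!}{\sum_{y=0}^\infty e^{\theta y}/f(y)!},$$ and let $\mathbf{E}^\theta$ denote expectation when $X$ has distribution $\mu^\theta$. The function $\varrho(\theta):=\mathbf{E}^\theta X$ is strictly increasing on $(-\infty,\bar\theta)$; $\theta(\varrho)$ denotes its inverse function, defined on the range of $\varrho(\cdot)$. The hydrodynamic flux function is $\mathcal{H}(\varrho):=\mathbf{E}^{\theta(\varrho)}f(X)$, for $\varrho$ in the range of $\varrho(\cdot)$. Convexity (concavity) of $f$ on the nonnegative integers means that $x\mapsto f(x+1)-f(x)$ is non-decreasing (non-increasing); $f$ is linear if $f(x+1)-f(x)$ is constant. *)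

(* Defs.v *)
From HB Require Import structures.
From mathcomp Require Import all_boot all_order all_algebra.
From mathcomp Require Import all_classical all_reals all_analysis.

Set Implicit Arguments.
Unset Strict Implicit.
Unset Printing Implicit Defensive.

Import Order.TTheory GRing.Theory Num.Theory.
Import numFieldNormedType.Exports.

Local Open Scope classical_set_scope.
Local Open Scope ring_scope.
Local Open Scope convex_scope.

(* Companions of the library's [convex_function]; endpoints and equal points
   have to be excluded for the strict inequalities. *)
Section convexity.
Context {R : realType}.
Implicit Types (D : set R) (h : R -> R^o).

Definition concave_function D h := forall t : {i01 R},
  {in D &, forall x y : R^o, h x <| t |> h y <= h (x <| t |> y)}.

Definition strictly_convex_function D h := forall t : {i01 R},
  0 < t%:num < 1 ->
  {in D &, forall x y : R^o, x != y -> h (x <| t |> y) < h x <| t |> h y}.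

Definition strictly_concave_function D h := forall t : {i01 R},
  0 < t%:num < 1 ->
  {in D &, forall x y : R^o, x != y -> h x <| t |> h y < h (x <| t |> y)}.

End convexity.

Section zero_range.
Context {R : realType}.
Implicit Types (f : nat -> {nonneg R}) (theta r : R).

Definition convex_rate f :=
  nondecreasing_seq (fun x => (f x.+1)%:num - (f x)%:num).

Definition concave_rate f :=
  nonincreasing_seq (fun x => (f x.+1)%:num - (f x)%:num).

Definition linear_rate f :=
  exists c : R, forall x, (f x.+1)%:num - (f x)%:num = c.

Definition rate_fact f (x : nat) : R := \prod_(1 <= y < x.+1) (f y)%:num.

Lemma rate_fact_ge0 f x : 0 <= rate_fact f x.
Proof. by apply: prodr_ge0 => y _. Qed.

(* The junk exponent 0^-1 = 0 at x = 0 does not affect the lower limit. *)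
Definition theta_bar f : \bar R :=
  lne (limn_einf (fun x => (rate_fact f x `^ (x%:R)^-1)%:E)).

Definition weight f theta (x : nat) : R :=
  expR (theta * x%:R) / rate_fact f x.

Lemma weight_ge0 f theta x : 0 <= weight f theta x.
Proof. by rewrite divr_ge0 ?expR_ge0 ?rate_fact_ge0. Qed.

Definition weight_measure f theta : {measure set nat -> \bar R} :=
  mseries (fun x => mscale (NngNum (weight_ge0 f theta x)) \d_x) 0.

(* [mnormalize] divides by the total mass when the latter is positive and
   finite, in particular for theta < theta_bar f (see [mu_set1]); otherwise it
   returns the default \d_0, which only makes the definition total. *)
Definition mu f theta : probability nat R :=
  mnormalize (weight_measure f theta) (\d_(0%N) : probability nat R).

Lemma weight_measure_set1 f theta x :
  weight_measure f theta [set x] = (weight f theta x)%:E.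
Proof.
rewrite /weight_measure /= /mseries (@nneseriesD1 _ _ x)//=.
rewrite eseries0 ?adde0.
  by rewrite /mscale/= diracE mem_set//= mule1.
move=> i _ /= ix; rewrite /mscale/= diracE memNset ?mule0//=.
by apply/eqP.
Qed.

Lemma weight_measure_setT f theta :
  weight_measure f theta setT = (\sum_(0 <= x <oo) (weight f theta x)%:E)%E.
Proof.
rewrite /weight_measure /= /mseries; apply: eq_eseriesr => i _ /=.
by rewrite /mscale /= diracT mule1.
Qed.

Lemma weight_le_geometric f theta : (theta%:E < theta_bar f)%E ->
  exists (q : R) N, 0 < q < 1 /\ forall x, (N <= x)%N -> weight f theta x <= q ^+ x.
Proof.
move=> tb.
have [r tr rb] : exists2 r, theta < r & (r%:E < theta_bar f)%E.
  move: tb; case: (theta_bar f) => [b| |//].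
    rewrite lte_fin => tb; exists ((theta + b) / 2); first by rewrite midf_lt.
    by rewrite lte_fin midf_lt.
  by exists (theta + 1); rewrite ?ltrDl// ltry.
have {rb} : ((expR r)%:E <
    limn_einf (fun x => (rate_fact f x `^ (x%:R)^-1)%:E))%E.
  move: rb; rewrite /theta_bar; case: (limn_einf _) => [l| |]//=.
    have [//|l0] := leP l 0; rewrite !lte_fin => rl.
    by rewrite -[ltRHS]lnK ?posrE ?ltr_expR.
  by move=> _; exact: ltry.
rewrite limn_einf_lim (cvg_lim _ (ereal_nondecreasing_cvgn _))//; last first.
  exact: nondecreasing_einfs.
move=> /ereal_sup_gt[_ [N _ <-]] rN.
exists (expR (theta - r)), N.+1; split.
  by rewrite expR_gt0 -[ltRHS]expR0 ltr_expR subr_lt0.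
move=> x Nx.
have : ((expR r)%:E < (rate_fact f x `^ (x%:R)^-1)%:E)%E.
  apply: (lt_le_trans rN); apply: ereal_inf_lbound.
  by exists x => //=; exact: ltnW.
rewrite lte_fin => rx.
have x0 : (0 < x%:R :> R) by rewrite ltr0n (leq_trans _ Nx).
have {}rx : expR (r * x%:R) <= rate_fact f x.
  rewrite expRM; apply: (@le_trans _ _ ((rate_fact f x `^ x%:R^-1) `^ x%:R)).
    by rewrite ge0_ler_powR ?nnegrE ?expR_ge0 ?powR_ge0 ?ltW.
  by rewrite -powRrM mulVf ?gt_eqF// powRr1// rate_fact_ge0.
rewrite /weight ler_pdivrMr; last exact: lt_le_trans (expR_gt0 _) rx.
rewrite -expRM_natr mulrBl expRB -mulrA ler_peMr ?expR_ge0//.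
by rewrite mulrC ler_pdivlMr ?expR_gt0// mul1r.
Qed.

Lemma is_cvg_weight f theta : (theta%:E < theta_bar f)%E ->
  cvgn (series (weight f theta)).
Proof.
move=> /weight_le_geometric[q [N [/andP[q0 q1] wq]]].
rewrite -(is_cvg_series_restrict N).
have : cvgn (series (geometric 1 q)).
  by apply: is_cvg_geometric_series; rewrite ger0_norm// ltW.
rewrite -(is_cvg_series_restrict N) => cq.
apply: nondecreasing_is_cvgn.
  by apply: nondecreasing_series => i _ _; exact: weight_ge0.
have /cvg_seq_bounded/bounded_fun_has_ubound[M qM] := cq.
exists M => _ [n _ <-]; apply: le_trans (qM _ (imageT _ n)).
by apply: ler_sum_nat => i /andP[Ni _]; rewrite /geometric/= mul1r wq.
Qed.

Lemma weight_series_fin f theta : (theta%:E < theta_bar f)%E ->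
  (\sum_(0 <= x <oo) (weight f theta x)%:E)%E =
  (limn (series (weight f theta)))%:E.
Proof.
move=> /is_cvg_weight cw; rewrite -EFin_lim//.
by apply/congr_lim/funext => n /=; rewrite sumEFin.
Qed.

Lemma mu_set1 f theta x : (theta%:E < theta_bar f)%E ->
  mu f theta [set x] =
  (weight f theta x / limn (series (weight f theta)))%:E.
Proof.
move=> tb; have wT := weight_measure_setT f theta.
rewrite (weight_series_fin tb) in wT.
have w0 : 0 < limn (series (weight f theta)).
  rewrite -lte_fin -(weight_series_fin tb) (@nneseriesD1 _ _ 0%N)//; last first.
    by move=> k _; rewrite lee_fin weight_ge0.
  apply: (@lt_le_trans _ _ (weight f theta 0)%:E).
    by rewrite /weight /rate_fact big_geq// mulr0 expR0 divr1 lte_fin.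
  by rewrite leeDl// nneseries_ge0// => k _ _; rewrite lee_fin weight_ge0.
rewrite /mu /= /mnormalize wT eqe gt_eqF//= weight_measure_set1.
by rewrite -EFinM.
Qed.

(* [fine] turns the extended real expectation into a real. *)
Definition density f theta : R := fine 'E_(mu f theta)[fun x => x%:R].

Definition theta_dom f : set R := [set theta | (theta%:E < theta_bar f)%E].

Definition density_range f : set R := density f @` theta_dom f.

(* The inverse of [density f] from [density_range f] to [theta_dom f]. *)
Definition theta_of f : R -> R := 'pinv_(fun=> 0) (theta_dom f) (density f).

Definition flux f r : R :=
  fine 'E_(mu f (theta_of f r))[fun x => (f x)%:num].

End zero_range.

(* Main.v *)
(** Write lambda = exp theta, w_theta (x) = lambda^x / f(x)!, and let Z and M be
    the sums of w_theta (x) and x w_theta (x), so that rho = M / Z. Since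
    f (x+1) w_theta (x+1) = lambda w_theta (x), the flux at density rho (theta)
    is lambda, and convexity of the flux says that for
    theta_1 < theta_2 < theta_3 the determinant with rows
    (Z_i, M_i, lambda_i Z_i) is nonnegative. By the Cauchy-Binet (Andreief)
    identity this determinant is the sum over x < y < z of
      det (lambda_i ^ x_j) det (1, x_j, f (x_j)) / (f(x)! f(y)! f(z)!),
    where the first factor is a generalized Vandermonde determinant, hence
    positive, and the second one is nonnegative exactly when f is convex. A
    single positive term gives strictness. *)
Require Import Defs.
From mathcomp Require Import all_boot all_order all_algebra ring lra.
From mathcomp Require Import all_classical all_reals all_analysis.
Import Order.TTheory GRing.Theory Num.Theory.
Import numFieldNormedType.Exports.

Set Implicit Arguments.
Unset Strict Implicit.
Unset Printing Implicit Defensive.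

Local Open Scope classical_set_scope.
Local Open Scope ring_scope.

(** * Determinants of order three and the Andreief identity *)

(** The determinant with rows [u], [v], [w] and columns [x], [y], [z], expanded along the row
    [u]. *)
Definition det3 (R : comNzRingType) (u v w : nat -> R) (x y z : nat) : R :=
  u x * (v y * w z - v z * w y) - u y * (v x * w z - v z * w x)
  + u z * (v x * w y - v y * w x).

Lemma sum3_prod (R : comNzRingType) (N : nat) (p q r : nat -> R) :
  \sum_(0 <= x < N) \sum_(0 <= y < N) \sum_(0 <= z < N) p x * q y * r z =
  (\sum_(0 <= x < N) p x) * (\sum_(0 <= x < N) q x) * (\sum_(0 <= x < N) r x).
Proof.
rewrite -mulrA mulr_suml; apply: eq_bigr => x _.
rewrite mulr_suml mulr_sumr; apply: eq_bigr => y _.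
by rewrite mulrA mulr_sumr.
Qed.

Lemma sum3D (R : comNzRingType) (N : nat) (F G : nat -> nat -> nat -> R) :
  \sum_(0 <= x < N) \sum_(0 <= y < N) \sum_(0 <= z < N) (F x y z + G x y z) =
  \sum_(0 <= x < N) \sum_(0 <= y < N) \sum_(0 <= z < N) F x y z +
  \sum_(0 <= x < N) \sum_(0 <= y < N) \sum_(0 <= z < N) G x y z.
Proof.
by rewrite -big_split; apply: eq_bigr => x _; rewrite -big_split;
  apply: eq_bigr => y _; rewrite -big_split.
Qed.

(** Multilinearity in the columns: each column carries its own weight, so summing over the columns
    one by one leaves the determinant of the sums [S]. *)
Lemma sum3_det3 (R : comNzRingType) (N : nat) (p q r u v w : nat -> R) :
  let S g h := \sum_(0 <= x < N) g x * h x in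
  \sum_(0 <= x < N) \sum_(0 <= y < N) \sum_(0 <= z < N)
    p x * q y * r z * det3 u v w x y z =
  S p u * (S q v * S r w - S r v * S q w)
  - S q u * (S p v * S r w - S r v * S p w)
  + S r u * (S p v * S q w - S q v * S p w).
Proof.
move=> S.
transitivity (\sum_(0 <= x < N) \sum_(0 <= y < N) \sum_(0 <= z < N)
  ((p x * u x) * (q y * v y) * (r z * w z)
   + ((- (p x * u x)) * (q y * w y) * (r z * v z)
   + ((- (p x * v x)) * (q y * u y) * (r z * w z)
   + ((p x * w x) * (q y * u y) * (r z * v z)
   + ((p x * v x) * (q y * w y) * (r z * u z)
   + ((- (p x * w x)) * (q y * v y) * (r z * u z)))))))).
  by do 3!(apply: eq_bigr => ? _); rewrite /det3; ring.
rewrite !sum3D !sum3_prod !sumrN -/(S p u) -/(S p v) -/(S p w) -/(S q u)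
  -/(S q v) -/(S q w) -/(S r u) -/(S r v) -/(S r w).
ring.
Qed.

(* The Andreief (Cauchy-Binet) identity for a 3 x 3 determinant, kept as a sum
   over all triples: the summand is symmetric in (x, y, z). *)
Lemma andreief3 (R : comNzRingType) (N : nat) (p q r u v w : nat -> R) :
  let S g h := \sum_(0 <= x < N) g x * h x in
  \sum_(0 <= x < N) \sum_(0 <= y < N) \sum_(0 <= z < N)
    det3 p q r x y z * det3 u v w x y z =
  (S p u * (S q v * S r w - S r v * S q w)
  - S q u * (S p v * S r w - S r v * S p w)
  + S r u * (S p v * S q w - S q v * S p w)) *+ 6.
Proof.
move=> S; pose D := det3 u v w.
transitivity (\sum_(0 <= x < N) \sum_(0 <= y < N) \sum_(0 <= z < N)
  (p x * q y * r z * D x y z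
  + ((\- p) x * r y * q z * D x y z
  + ((\- q) x * p y * r z * D x y z
  + (r x * p y * q z * D x y z
  + (q x * r y * p z * D x y z
  + ((\- r) x * q y * p z * D x y z))))))).
  by do 3!(apply: eq_bigr => ? _); rewrite /D {1}/det3 /=; ring.
have SN g h : \sum_(0 <= x < N) (\- g) x * h x = - S g h.
  by rewrite -sumrN; apply: eq_bigr => x _; rewrite /= mulNr.
rewrite !sum3D !sum3_det3 !SN -/(S p u) -/(S p v) -/(S p w) -/(S q u)
  -/(S q v) -/(S q w) -/(S r u) -/(S r v) -/(S r w).
by ring.
Qed.

(** The product is invariant under permutations of the triple and vanishes when two indices
    coincide, so only increasing triples and the value 0 have to be checked. *)
Lemma det3_mul_sym (R : comNzRingType) (p q r u v w : nat -> R)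
    (P : R -> Prop) :
  P 0 ->
  (forall x y z, (x < y < z)%N -> P (det3 p q r x y z * det3 u v w x y z)) ->
  forall x y z, P (det3 p q r x y z * det3 u v w x y z).
Proof.
move=> P0 Pord.
pose F x y z := det3 p q r x y z * det3 u v w x y z.
have F12 x y z : F x y z = F y x z by rewrite /F /det3; ring.
have F23 x y z : F x y z = F x z y by rewrite /F /det3; ring.
have Fd x y : F x x y = 0 by rewrite /F /det3; ring.
have Fle x y z : (x <= y <= z)%N -> P (F x y z).
  move=> /andP[]; rewrite leq_eqVlt => /predU1P[->|xy].
    by rewrite Fd.
  rewrite leq_eqVlt => /predU1P[<-|yz].
    by rewrite F12 F23 Fd.
  by apply: Pord; rewrite xy yz.
move=> x y z; rewrite -/(F x y z).
have [xy|yx] := leqP x y; have [yz|zy] := leqP y z; have [xz|zx] := leqP x z.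
- by apply: Fle; rewrite xy.
- by apply: Fle; rewrite xy.
- by rewrite F23; apply: Fle; rewrite xz ltnW.
- by rewrite F23 F12; apply: Fle; rewrite (ltnW zx).
- by rewrite F12; apply: Fle; rewrite (ltnW yx).
- by rewrite F12 F23; apply: Fle; rewrite yz ltnW.
- by rewrite F12 F23 F12; apply: Fle; rewrite (ltnW zy) ltnW.
- by rewrite F12 F23 F12; apply: Fle; rewrite (ltnW zy) ltnW.
Qed.

(** * Positivity of the generalized Vandermonde determinant *)

(** This is the step from k = n + 1 to k = n + 2 in the monotonicity of (p^k - 1) / k. Passing from
    n to n + 1 multiplies the expression by p and adds (p - 1)(p^(n+2) - 1), whose two factors have
    the same sign. *)
Lemma expr_tangent_gt0 (R : realDomainType) (p : R) (n : nat) :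
  0 < p -> p != 1 -> 0 < n.+1%:R * p ^+ n.+2 - n.+2%:R * p ^+ n.+1 + 1.
Proof.
move=> p0 p1; elim: n => [|n IHn].
  rewrite (_ : _ + 1 = (p - 1) ^+ 2); last by ring.
  by rewrite exprn_even_gt0 //= subr_eq0.
have -> : n.+2%:R * p ^+ n.+3 - n.+3%:R * p ^+ n.+2 + 1 =
   p * (n.+1%:R * p ^+ n.+2 - n.+2%:R * p ^+ n.+1 + 1) +
   (p - 1) * (p ^+ n.+2 - 1).
  by rewrite -(natr1 n.+2) -(natr1 n.+1) !(exprS p); ring.
rewrite ltr_pwDl ?mulr_gt0 // subrX1 mulrA -expr2 mulr_ge0 ?sqr_ge0 //.
by rewrite sumr_ge0 // => i _; rewrite exprn_ge0 // ltW.
Qed.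

(** The one-step inequalities of [expr_tangent_gt0] chain up, since the claim is the strict growth
    of (p^k - 1) / k with denominators cleared. *)
Lemma expr_chord (R : realDomainType) (p : R) (u v : nat) :
  0 < p -> p != 1 -> (0 < u < v)%N ->
  v%:R * (p ^+ u - 1) < u%:R * (p ^+ v - 1).
Proof.
move=> p0 p1 /andP[u0 uv].
have {uv} [k ->] : exists k, v = (u + k.+1)%N.
  by exists (v - u).-1; rewrite prednK ?subn_gt0 // subnKC // ltnW.
case: u u0 => // n _.
elim: k => [|k IHk].
  have := expr_tangent_gt0 n p0 p1; rewrite addn1 -(natr1 n.+1); lra.
have u0 : 0 < n.+1%:R :> R by rewrite ltr0n.
set m := (n.+1 + k.+1)%N in IHk *.
have mS : (n.+1 + k.+2 = m.+1)%N by rewrite addnS.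
have m0 : 0 < m%:R :> R by rewrite ltr0n.
rewrite mS -(ltr_pM2l m0).
have m1 : 0 < m.+1%:R :> R by rewrite ltr0n.
have step : m.+1%:R * (p ^+ m - 1) < m%:R * (p ^+ m.+1 - 1).
  have := expr_tangent_gt0 m.-1 p0 p1.
  by rewrite /m addSn /= -(natr1 (n + k.+1).+1); lra.
rewrite mulrCA; apply: (@lt_trans _ _ (m.+1%:R * (n.+1%:R * (p ^+ m - 1)))).
  by rewrite ltr_pM2l.
by rewrite mulrCA [ltRHS]mulrCA ltr_pM2l.
Qed.

(** Dividing by powers of the middle base [b] reduces to bases p < 1 < q. Then [expr_chord]
    separates two ratios: (1 - p^v) / (1 - p^u) < v / u < (q^v - 1) / (q^u - 1). *)
Lemma vandermonde3_gt0 (R : realFieldType) (a b c : R) (x y z : nat) :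
  0 < a < b -> b < c -> (x < y < z)%N ->
  0 < det3 (fun n => a ^+ n) (fun n => b ^+ n) (fun n => c ^+ n) x y z.
Proof.
move=> /andP[a0 ab] bc /andP[xy yz].
have b0 : 0 < b := lt_trans a0 ab.
have c0 : 0 < c := lt_trans b0 bc.
have [u0 uv] : (0 < y - x)%N /\ (y - x < z - x)%N.
  by rewrite subn_gt0 ltn_subRL subnKC ?(ltnW xy).
rewrite -(subnKC (ltnW xy)) -(subnKC (ltnW (ltn_trans xy yz))).
move: (y - x)%N (z - x)%N u0 uv => u v u0 uv.
pose p := a / b; pose q := c / b.
have p0 : 0 < p by rewrite divr_gt0.
have q0 : 0 < q by rewrite divr_gt0.
have p1 : p < 1 by rewrite ltr_pdivrMr // mul1r.
have q1 : 1 < q by rewrite ltr_pdivlMr // mul1r.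
have -> : a = p * b by rewrite divfK // gt_eqF.
have -> : c = q * b by rewrite divfK // gt_eqF.
rewrite (_ : det3 _ _ _ _ _ _ = (p * q) ^+ x * b ^+ (x + x + x + u + v) *
  ((1 - p ^+ u) * (q ^+ v - 1) - (1 - p ^+ v) * (q ^+ u - 1))); last first.
  rewrite /det3 !exprMn !exprD; ring.
rewrite mulr_gt0 //; first by rewrite mulr_gt0 // exprn_gt0 // mulr_gt0.
have U : 0 < u%:R :> R by rewrite ltr0n.
have pc : v%:R * (p ^+ u - 1) < u%:R * (p ^+ v - 1).
  by apply: expr_chord; rewrite ?u0 // lt_eqF.
have qc : v%:R * (q ^+ u - 1) < u%:R * (q ^+ v - 1).
  by apply: expr_chord; rewrite ?u0 // gt_eqF.
have pu : p ^+ u < 1 by rewrite exprn_ilt1 ?lt0n_neq0 // ltW.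
have qu : 1 < q ^+ u by rewrite exprn_egt1 // -lt0n.
(* After multiplication by u, the claim is the sum of the two products below, whose terms in v
   cancel. *)
rewrite -(pmulr_rgt0 _ U).
have : 0 < (1 - p ^+ u) * (u%:R * (q ^+ v - 1) - v%:R * (q ^+ u - 1)).
  by rewrite mulr_gt0 ?subr_gt0.
have : 0 < (q ^+ u - 1) * (u%:R * (p ^+ v - 1) - v%:R * (p ^+ u - 1)).
  by rewrite mulr_gt0 ?subr_gt0.
lra.
Qed.

(** * Convex sequences and the determinant with rows 1, n, g *)

(** The increment at [y] serves as the slope of a line supporting [g] at [y], to the right and to
    the left. *)
Lemma convex_slopes (R : realDomainType) (g : nat -> R) (y k : nat) :
  nondecreasing_seq (fun x => g x.+1 - g x) ->
  (g y.+1 - g y) *+ k <= g (y + k)%N - g y /\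
  ((k <= y)%N -> g y - g (y - k)%N <= (g y.+1 - g y) *+ k).
Proof.
move=> gcvx; split.
  elim: k => [|k IHk]; first by rewrite addn0 subrr.
  have /= := gcvx y (y + k)%N (leq_addr k y).
  rewrite addnS mulrSr; lra.
elim: k => [_|k IHk ky]; first by rewrite subn0 subrr.
have := IHk (ltnW ky); have /= := gcvx (y - k.+1)%N y (leq_subr _ _).
rewrite -subSn // subSS mulrSr; lra.
Qed.

(** With s the increment at [y], the determinant is (y - x)(g z - g y - (z - y) s) + (z - y)((y - x)
    s - (g y - g x)), and [convex_slopes] makes both terms nonnegative. *)
Lemma convex_det3_ge0 (R : realDomainType) (g : nat -> R) (x y z : nat) :
  nondecreasing_seq (fun x => g x.+1 - g x) -> (x < y < z)%N ->
  0 <= det3 (fun=> 1) (fun n => n%:R) g x y z.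
Proof.
move=> gcvx /andP[/ltnW xy /ltnW yz].
have [zy _] := convex_slopes y (z - y) gcvx.
have [_ /(_ (leq_subr _ _)) yx] := convex_slopes y (y - x) gcvx.
rewrite subnKC // -[_ *+ _]mulr_natl -subr_ge0 in zy.
rewrite subKn // -[_ *+ _]mulr_natl -subr_ge0 in yx.
have := mulr_ge0 (ler0n R (z - y)) yx; have := mulr_ge0 (ler0n R (y - x)) zy.
rewrite !natrB // /det3; lra.
Qed.

(** On consecutive indices the determinant is the second difference of [g]; if none is positive, the
    increments are constant. *)
Lemma nonlinear_det3_gt0 (R : realDomainType) (g : nat -> R) :
  nondecreasing_seq (fun x => g x.+1 - g x) ->
  ~ (exists c, forall x, g x.+1 - g x = c) ->
  exists x, 0 < det3 (fun=> 1) (fun n => n%:R) g x x.+1 x.+2.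
Proof.
move=> gcvx; apply: contra_notP => /forallNP H.
exists (g 1%N - g 0%N); elim=> // n IHn; rewrite -IHn.
apply/le_anti/andP; split; last exact: gcvx.
have /negP := H n; rewrite -leNgt /det3 -(natr1 n.+1) -(natr1 n).
lra.
Qed.

(** * Determinants of moments given by infinite series *)

Lemma ler_term_sum (R : numDomainType) (F : nat -> R) (n N : nat) :
  (forall i, 0 <= F i) -> (n < N)%N -> F n <= \sum_(0 <= i < N) F i.
Proof.
move=> F0 nN; rewrite (bigD1_seq n) ?mem_index_iota ?iota_uniq //=.
by rewrite lerDl sumr_ge0.
Qed.

Lemma ler_term_sum3 (R : numDomainType) (F : nat -> nat -> nat -> R)
    (x y z N : nat) :
  (forall x y z, 0 <= F x y z) -> (x < N)%N -> (y < N)%N -> (z < N)%N ->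
  F x y z <= \sum_(0 <= x < N) \sum_(0 <= y < N) \sum_(0 <= z < N) F x y z.
Proof.
move=> F0 xN yN zN.
apply: le_trans (ler_term_sum _ xN); last first.
  by move=> i; rewrite !sumr_ge0 // => j _; rewrite sumr_ge0.
apply: le_trans (ler_term_sum _ yN); last by move=> j; rewrite sumr_ge0.
exact: ler_term_sum.
Qed.

Lemma cvg_series_gt0 (R : realType) (h : nat -> R) (l : R) (n : nat) :
  (forall x, 0 <= h x) -> 0 < h n -> series h @ \oo --> l -> 0 < l.
Proof.
move=> h0 hn hl; apply: (lt_le_trans hn); rewrite -(cvg_lim _ hl) //.
apply: limr_ge; first by apply/cvg_ex; exists l.
near=> N; apply: ler_term_sum => //.
by near: N; exact: nbhs_infty_gt.
Unshelve. all: by end_near. Qed.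

Definition moment (R : realType) (p h : nat -> R) : R :=
  limn (series (fun x => p x * h x)).

Definition has_moment (R : realType) (p h : nat -> R) : Prop :=
  cvgn (series (fun x => p x * h x)).

Definition has_moments (R : realType) (u v w p : nat -> R) : Prop :=
  [/\ has_moment p u, has_moment p v & has_moment p w].

(** The determinant with rows [u], [v], [w] and columns [p], [q], [r] whose entries are moments: the
    limit of the one in [andreief3]. *)
Definition moment_det3 (R : realType) (p q r u v w : nat -> R) : R :=
  moment p u * (moment q v * moment r w - moment r v * moment q w)
  - moment q u * (moment p v * moment r w - moment r v * moment p w)
  + moment r u * (moment p v * moment q w - moment q v * moment p w).

Section moment_det.
Variables (R : realType) (p q r u v w : nat -> R).
Hypotheses (sp : has_moments u v w p) (sq : has_moments u v w q)
  (sr : has_moments u v w r).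
Hypothesis det_ge0 : forall x y z, (x < y < z)%N ->
  0 <= det3 p q r x y z * det3 u v w x y z.

Let G N := \sum_(0 <= x < N) \sum_(0 <= y < N) \sum_(0 <= z < N)
  det3 p q r x y z * det3 u v w x y z.

Let cvg_G : G @ \oo --> moment_det3 p q r u v w *+ 6.
Proof.
rewrite (_ : G = fun N => (
  series (fun x => p x * u x) N *
    (series (fun x => q x * v x) N * series (fun x => r x * w x) N -
     series (fun x => r x * v x) N * series (fun x => q x * w x) N)
  - series (fun x => q x * u x) N *
    (series (fun x => p x * v x) N * series (fun x => r x * w x) N -
     series (fun x => r x * v x) N * series (fun x => p x * w x) N)
  + series (fun x => r x * u x) N *
    (series (fun x => p x * v x) N * series (fun x => q x * w x) N -
     series (fun x => q x * v x) N * series (fun x => p x * w x) N)) *+ 6);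
  last by apply/funext => N; rewrite /G andreief3.
case: sp sq sr => pu pv pw [qu qv qw] [ru rv rw].
apply: cvgMn; apply: cvgD; [apply: cvgB|]; apply: cvgM => //;
  by apply: cvgB; apply: cvgM.
Qed.

(** All summands of the Andreief sum are nonnegative, so each is below the large partial sums and
    hence below their limit. The factor 6 counts the orderings of a triple. *)
Lemma term_le_moment_det3 x y z :
  det3 p q r x y z * det3 u v w x y z <= moment_det3 p q r u v w *+ 6.
Proof.
rewrite -(cvg_lim _ cvg_G) //; apply: limr_ge.
  by apply/cvg_ex; eexists; exact: cvg_G.
near=> N.
apply: (ler_term_sum3 (F := fun x y z => det3 p q r x y z * det3 u v w x y z)).
- by apply: (det3_mul_sym (P := fun c => 0 <= c)).
- by near: N; exact: nbhs_infty_gt.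
- by near: N; exact: nbhs_infty_gt.
- by near: N; exact: nbhs_infty_gt.
Unshelve. all: by end_near. Qed.

Lemma moment_det3_ge0 : 0 <= moment_det3 p q r u v w.
Proof.
rewrite -(pmulrn_lge0 _ (isT : 0 < 6)%N).
apply: le_trans (term_le_moment_det3 0%N 0%N 0%N).
exact: (det3_mul_sym (P := fun c => 0 <= c)).
Qed.

Lemma moment_det3_gt0 x y z : 0 < det3 p q r x y z * det3 u v w x y z ->
  0 < moment_det3 p q r u v w.
Proof.
move=> xyz; rewrite -(pmulrn_lgt0 _ (isT : 0 < 6)%N).
exact: lt_le_trans (term_le_moment_det3 x y z).
Qed.

End moment_det.

(** * Power series in exp t, for t in a set without largest element *)

Section power_series.
Variables (R : realType) (J : set R).
Hypothesis J_right : forall t, J t -> exists2 t', t < t' & J t'.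

(** A larger exponent t' absorbs the factor n, because n (t' - t) <= exp ((t' - t) n). *)
Lemma is_cvg_pseries_natmul (c : nat -> R) :
  (forall n, 0 <= c n) -> (forall t, J t -> cvgn (pseries c (expR t))) ->
  forall t, J t -> cvgn (pseries (fun n => n%:R * c n) (expR t)).
Proof.
move=> c0 cJ t /J_right[t' tt' Jt'].
have d0 : 0 < t' - t by rewrite subr_gt0.
apply: (@series_le_cvg _ _ (fun n => (t' - t)^-1 * (c n * expR t' ^+ n))).
- by move=> n; rewrite !mulr_ge0 // exprn_ge0 // expR_ge0.
- by move=> n; rewrite !mulr_ge0 ?invr_ge0 ?(ltW d0) // exprn_ge0 // expR_ge0.
- move=> n; rewrite ler_pdivlMl // -[t' in leRHS](subrK t) expRD exprMn.
  have -> : (t' - t) * (n%:R * c n * expR t ^+ n) =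
    c n * (n%:R * (t' - t) * expR t ^+ n) by ring.
  rewrite ler_wpM2l // ler_wpM2r ?exprn_ge0 ?expR_ge0 //.
  by rewrite -expRM_natr (le_trans _ (expR_ge1Dx _)) // mulrC lerDr.
- exact/is_cvg_seriesZ/cJ.
Qed.

Lemma is_cvg_pseries_diffs (c : nat -> R) :
  (forall n, 0 <= c n) -> (forall t, J t -> cvgn (pseries c (expR t))) ->
  forall t, J t -> cvgn (pseries (pseries_diffs c) (expR t)).
Proof.
move=> c0 cJ t Jt; have := is_cvg_pseries_natmul c0 cJ Jt.
rewrite /pseries => /cvg_ex[l cl].
apply/cvg_ex; exists ((expR t)^-1 * l).
rewrite (_ : series _ = fun N => (expR t)^-1 *
    series (fun n => n%:R * c n * expR t ^+ n) N.+1).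
  by apply: cvgMl_tmp; rewrite (cvg_shiftS (series _)).
apply/funext => N; rewrite /series /= big_nat_recl // !mul0r add0r mulr_sumr.
apply: eq_bigr => n _; rewrite /pseries_diffs exprS mulrCA mulKf //.
by rewrite gt_eqF // expR_gt0.
Qed.

(** Differentiability comes from [pseries_snd_diffs], which asks for convergence of the series and
    of its first two derived series at a point of larger modulus, here exp t'. *)
Lemma continuous_pseries_expR (c : nat -> R) (t : R) :
  (forall n, 0 <= c n) -> (forall t, J t -> cvgn (pseries c (expR t))) ->
  J t -> {for t, continuous (fun t => limn (pseries c (expR t)))}.
Proof.
move=> c0 cJ /J_right[t' tt' Jt'].
have c'J := is_cvg_pseries_diffs c0 cJ.
have c'0 n : 0 <= pseries_diffs c n by rewrite mulr_ge0.
have [] := pseries_snd_diffs (cJ _ Jt') (c'J _ Jt')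
  (is_cvg_pseries_diffs c'0 c'J Jt') (x := expR t).
  by rewrite !ger0_norm ?expR_ge0 // ltr_expR.
move=> /derivable1_diffP/differentiable_continuous cc _.
by apply: continuous_comp cc; exact: continuous_expR.
Qed.

End power_series.

(** * Moments of the weights and expectations under [mu] *)

Section zero_range_moments.
Variables (R : realType) (f : nat -> {nonneg R}).
Hypotheses (f_nd : nondecreasing_seq (fun x => (f x)%:num))
  (f0 : (f 0%N)%:num = 0) (f1 : 0 < (f 1%N)%:num).
Implicit Types (t : R).

Lemma rate_gt0 x : 0 < (f x.+1)%:num.
Proof. by apply: lt_le_trans f1 _; exact: f_nd. Qed.

Lemma rate_factS x : rate_fact f x.+1 = rate_fact f x * (f x.+1)%:num.
Proof. by rewrite /rate_fact big_nat_recr. Qed.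

Lemma rate_fact_gt0 x : 0 < rate_fact f x.
Proof.
elim: x => [|x IHx]; first by rewrite /rate_fact big_geq.
by rewrite rate_factS mulr_gt0 // rate_gt0.
Qed.

Lemma weight_gt0 t x : 0 < weight f t x.
Proof. by rewrite divr_gt0 ?expR_gt0 ?rate_fact_gt0. Qed.

Lemma weightS t x :
  weight f t x.+1 * (f x.+1)%:num = expR t * weight f t x.
Proof.
rewrite /weight rate_factS -natr1 mulrDr mulr1 expRD.
by field; rewrite !gt_eqF ?rate_gt0 ?rate_fact_gt0.
Qed.

(** Moments thus become power series in exp t, to which the convergence and continuity results above
    apply. *)
Lemma weight_pseries t h :
  series (fun x => weight f t x * h x) =
  pseries (fun x => h x / rate_fact f x) (expR t).
Proof.
apply/funext => N; apply: eq_bigr => x _.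
by rewrite /= /weight expRM_natr mulrC mulrAC mulrA.
Qed.

Lemma theta_dom_right t : theta_dom f t -> exists2 t', t < t' & theta_dom f t'.
Proof.
rewrite /theta_dom /=; case: (theta_bar f) => [b| |//].
  rewrite lte_fin => tb; exists ((t + b) / 2); first by rewrite midf_lt.
  by rewrite lte_fin midf_lt.
by exists (t + 1); rewrite ?ltrDl // ltry.
Qed.

Lemma theta_dom_le t t' : t <= t' -> theta_dom f t' -> theta_dom f t.
Proof. by move=> tt'; apply: le_lt_trans; rewrite lee_fin. Qed.

Lemma has_moment1 t : theta_dom f t -> has_moment (weight f t) (fun=> 1).
Proof.
rewrite /has_moment; under [fun x => _]funext do rewrite mulr1.
exact: is_cvg_weight.
Qed.

Lemma is_cvg_pseries_rate t : theta_dom f t ->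
  cvgn (pseries (fun x => 1 / rate_fact f x) (expR t)).
Proof. by move=> /has_moment1; rewrite /has_moment weight_pseries. Qed.

Let inv_fact_ge0 x : 0 <= 1 / rate_fact f x.
Proof. by rewrite divr_ge0 ?rate_fact_ge0. Qed.

Let natmulE : (fun x : nat => x%:R / rate_fact f x) =
  (fun x : nat => x%:R * (1 / rate_fact f x)).
Proof. by apply/funext => x; rewrite mul1r. Qed.

Lemma has_moment_natr t : theta_dom f t ->
  has_moment (weight f t) (fun x => x%:R).
Proof.
move=> tD; rewrite /has_moment weight_pseries natmulE.
exact: (is_cvg_pseries_natmul theta_dom_right inv_fact_ge0 is_cvg_pseries_rate).
Qed.

(** By [weightS] the series is that of the total mass shifted by one index and multiplied by exp t;
    the extra first term vanishes because f(0) = 0. *)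
Lemma cvg_moment_rate t : theta_dom f t ->
  series (fun x => weight f t x * (f x)%:num) @ \oo -->
  expR t * moment (weight f t) (fun=> 1).
Proof.
move=> tD; rewrite -(cvg_shiftS (series _)).
rewrite (_ : (fun n => _) =
    fun N => expR t * series (fun x => weight f t x * 1) N).
  by apply: cvgMl_tmp; exact: has_moment1.
apply/funext => N; rewrite /series /= big_nat_recl // f0 mulr0 add0r mulr_sumr.
by apply: eq_bigr => x _; rewrite weightS mulr1.
Qed.

Lemma has_moment_rate t : theta_dom f t ->
  has_moment (weight f t) (fun x => (f x)%:num).
Proof. by move=> tD; apply/cvg_ex; eexists; exact: cvg_moment_rate. Qed.

Lemma moment_rate t : theta_dom f t ->
  moment (weight f t) (fun x => (f x)%:num) =
  expR t * moment (weight f t) (fun=> 1).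
Proof. by move=> tD; apply: cvg_lim => //; exact: cvg_moment_rate. Qed.

Lemma moment1E t : moment (weight f t) (fun=> 1) = limn (series (weight f t)).
Proof.
by rewrite /moment; congr (limn (series _)); apply/funext => x; rewrite mulr1.
Qed.

Lemma moment1_gt0 t : theta_dom f t -> 0 < moment (weight f t) (fun=> 1).
Proof.
move=> tD; apply: (cvg_series_gt0 (n := 0%N) _ _ (has_moment1 tD)) => [x|].
  by rewrite mulr1 weight_ge0.
by rewrite mulr1 weight_gt0.
Qed.

(** The integral is split over the singletons, whose masses are given by [mu_set1]; nonnegativity of
    [g] justifies the countable splitting. *)
Lemma expectation_mu t (g : nat -> R) :
  theta_dom f t -> (forall x, 0 <= g x) -> has_moment (weight f t) g ->
  fine 'E_(mu f t)[g] = moment (weight f t) g / moment (weight f t) (fun=> 1).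
Proof.
move=> tD g0 sg; rewrite unlock.
have -> : [set: nat] = \bigcup_k [set k].
  by apply/seteqP; split => // x _; exists x.
rewrite ge0_integral_bigcup //.
- rewrite (eq_eseriesr (g := fun k =>
    (weight f t k * g k / moment (weight f t) (fun=> 1))%:E)); last first.
    move=> k _; rewrite (eq_integral (cst (g k)%:E)); last first.
      by move=> x; rewrite inE /= => ->.
    rewrite integral_cst // [X in (_ * X)%E](mu_set1 k tD) -EFinM moment1E.
    by rewrite mulrA [g k * _]mulrC.
  rewrite (_ : (\sum_(0 <= k <oo) _)%E =
    (moment (weight f t) g / moment (weight f t) (fun=> 1))%:E) //.
  apply: cvg_lim => //=.
  rewrite (_ : (fun n => _) = EFin \o (fun n =>
     series (fun x => weight f t x * g x) n / moment (weight f t) (fun=> 1))).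
    by apply: cvg_EFin; [exact: nearW|apply: cvgMr_tmp; exact: sg].
  by apply/funext => n /=; rewrite sumEFin mulr_suml.
- by move=> x _; rewrite lee_fin.
- by move=> i j _ _ [x [/= -> ->]].
Qed.

(** * The density as a function of theta, and the flux in parametric form *)

Lemma densityE t : theta_dom f t -> density f t =
  moment (weight f t) (fun x => x%:R) / moment (weight f t) (fun=> 1).
Proof. by move=> tD; apply: expectation_mu => //; exact: has_moment_natr. Qed.

(** Stated for the quotient of moments, since [densityE] identifies it with [density] only on
    [theta_dom]. *)
Lemma continuous_density t : theta_dom f t -> {for t, continuous (fun t =>
  moment (weight f t) (fun x => x%:R) / moment (weight f t) (fun=> 1))}.
Proof.
move=> tD.
have cM (h : nat -> R) : (forall x, 0 <= h x / rate_fact f x) ->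
    (forall t, theta_dom f t ->
       cvgn (pseries (fun x => h x / rate_fact f x) (expR t))) ->
    {for t, continuous (fun t => moment (weight f t) h)}.
  move=> h0 ch.
  rewrite (_ : (fun t => moment _ h) =
      fun t => limn (pseries (fun x => h x / rate_fact f x) (expR t))).
    exact: (continuous_pseries_expR theta_dom_right).
  by apply/funext => s; rewrite /moment weight_pseries.
apply: cvgM.
  apply: cM => [x|s sD]; first by rewrite divr_ge0 ?rate_fact_ge0.
  by rewrite -weight_pseries; exact: has_moment_natr.
apply: cvgV; first by rewrite gt_eqF // moment1_gt0.
by apply: cM => // s; exact: is_cvg_pseries_rate.
Qed.

(** With m the mean at t, it suffices that the sum of (x - m) w_t'(x) is positive. The same sum for
    w_t is zero, so a multiple of it may be subtracted to make every term nonnegative. *)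
Lemma lt_density t t' : theta_dom f t' -> t < t' -> density f t < density f t'.
Proof.
move=> t'D tt'; have tD := theta_dom_le (ltW tt') t'D.
rewrite [ltRHS]densityE // ltr_pdivlMr ?moment1_gt0 //.
set m := density f t; rewrite -subr_gt0.
have mE : moment (weight f t) (fun x => x%:R) = m * moment (weight f t) (fun=> 1).
  by rewrite /m densityE // divfK // gt_eqF // moment1_gt0.
(* The ratio w_t'(x) / w_t(x) evaluated at x = m: with this choice both factors in [hE] change sign
   at m. *)
pose e := expR ((t' - t) * m).
pose h x := (x%:R - m) * (weight f t' x - e * weight f t x).
have hE x : h x = (x%:R - m) * (expR ((t' - t) * x%:R) - e) * weight f t x.
  rewrite /h -mulrA [(expR _ - e) * _]mulrBl; congr (_ * (_ - _)).
  by rewrite /weight mulrA -expRD; congr (expR _ / _); ring.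
have d0 : 0 < t' - t by rewrite subr_gt0.
have h0 x : 0 <= h x.
  rewrite hE mulr_ge0 ?weight_ge0 //.
  have [xm|mx] := leP x%:R m.
    by rewrite mulr_le0 // subr_le0 // ler_expR ler_pM2l.
  by rewrite mulr_ge0 // subr_ge0 ?ler_expR ?ler_pM2l // ltW.
(* Only x = m gives a zero term, and m cannot equal both 0 and 1. *)
have [n hn] : exists n, 0 < h n.
  have hgt n : n%:R != m -> 0 < h n.
    case: (ltgtP n%:R m) => // nm _; rewrite hE mulr_gt0 ?weight_gt0 //.
      by rewrite nmulr_rgt0 subr_lt0 // ltr_expR ltr_pM2l.
    by rewrite mulr_gt0 // subr_gt0 // ltr_expR ltr_pM2l.
  have [m0|/hgt] := eqVneq 0%:R m; last by exists 0%N.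
  by exists 1%N; apply: hgt; rewrite -m0 oner_eq0.
apply: (@cvg_series_gt0 _ h _ n) => //.
rewrite (_ : series h = fun N =>
    (series (fun x => weight f t' x * x%:R) N
     - m * series (fun x => weight f t' x * 1) N)
    - e * (series (fun x => weight f t x * x%:R) N
     - m * series (fun x => weight f t x * 1) N)); last first.
  apply/funext => N; rewrite /series /= !mulr_sumr -!sumrB !mulr_sumr -sumrB.
  by apply: eq_bigr => x _; rewrite /h; ring.
have cM s : theta_dom f s ->
    (fun N => series (fun x => weight f s x * x%:R) N
      - m * series (fun x => weight f s x * 1) N) @ \oo -->
    moment (weight f s) (fun x => x%:R) - m * moment (weight f s) (fun=> 1).
  move=> sD; apply: cvgB; first exact: (has_moment_natr sD).
  by apply: cvgMl_tmp; exact: (has_moment1 sD).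
have := cvgB (cM _ t'D) (cvgMl_tmp (a := e) (cM _ tD)).
by rewrite mE subrr mulr0 subr0; apply.
Qed.

Lemma density_inj : {in theta_dom f &, injective (density f)}.
Proof.
move=> s t; rewrite !inE => sD tD st; case: (ltgtP s t) => // H.
  by have := lt_density tD H; rewrite st ltxx.
by have := lt_density sD H; rewrite st ltxx.
Qed.

(** Injectivity of the density eliminates [theta_of], so that the graph of the flux is the curve
    (density t, exp t). *)
Lemma flux_density t : theta_dom f t -> flux f (density f t) = expR t.
Proof.
move=> tD; rewrite /flux /theta_of pinvKV ?inE //; last exact: density_inj.
rewrite expectation_mu //; last exact: has_moment_rate.
by rewrite moment_rate // mulfK // gt_eqF // moment1_gt0.
Qed.

(** By the intermediate value theorem the density range has no gaps, so a convex combination of two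
    densities is again a density. *)
Lemma density_range_between s t r : theta_dom f t -> s < t ->
  density f s < r < density f t -> exists2 c, s < c < t & density f c = r.
Proof.
move=> tD st /andP[sr rt]; have sD := theta_dom_le (ltW st) tD.
pose g t := moment (weight f t) (fun x => x%:R) / moment (weight f t) (fun=> 1).
have [c] : exists2 c, c \in `[s, t] & g c = r.
  apply: IVT; first exact: ltW.
    apply: continuous_in_subspaceT => c.
    rewrite inE /= in_itv /= => /andP[_ ct].
    exact/continuous_density/(theta_dom_le ct).
  have st_le := ltW (lt_trans sr rt); rewrite /g -!densityE // min_l //.
  by rewrite max_r // (ltW sr) (ltW rt).
rewrite in_itv /= => /andP[sc ct]; have cD := theta_dom_le ct tD.
rewrite /g -densityE // => cr; exists c => //.
rewrite !lt_neqAle sc ct !andbT; apply/andP; split; apply/eqP => E.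
  by move: sr; rewrite E cr ltxx.
by move: rt; rewrite -E cr ltxx.
Qed.

(** * The chord inequality for the flux *)

(** Each column has a common factor 1 / f(x)!; taking it out leaves the generalized Vandermonde
    determinant. *)
Lemma det3_weight_gt0 t1 t2 t3 x y z : t1 < t2 -> t2 < t3 -> (x < y < z)%N ->
  0 < det3 (weight f t1) (weight f t2) (weight f t3) x y z.
Proof.
move=> t12 t23 xyz.
have wE t n : weight f t n = expR t ^+ n / rate_fact f n.
  by rewrite /weight expRM_natr.
rewrite (_ : det3 _ _ _ _ _ _ =
    det3 (fun n => expR t1 ^+ n) (fun n => expR t2 ^+ n) (fun n => expR t3 ^+ n)
      x y z / (rate_fact f x * rate_fact f y * rate_fact f z)); last first.
  rewrite /det3 !wE; field.
  by rewrite !gt_eqF ?rate_fact_gt0.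
rewrite divr_gt0 ?mulr_gt0 ?rate_fact_gt0 // vandermonde3_gt0 ?expR_gt0 //.
  by rewrite ltr_expR.
by rewrite ltr_expR.
Qed.

(* [c = 1] is the convex case, [c = -1] the concave one. *)
Lemma flux_chord (c : R) t1 t2 t3 :
  nondecreasing_seq (fun x => c * (f x.+1)%:num - c * (f x)%:num) ->
  t1 < t2 -> t2 < t3 -> theta_dom f t3 ->
  let D := c * ((density f t2 - density f t1) * (expR t3 - expR t2) -
     (density f t3 - density f t2) * (expR t2 - expR t1)) in
  0 <= D /\ (c != 0 -> ~ linear_rate f -> 0 < D).
Proof.
move=> cf t12 t23 t3D D.
have t2D := theta_dom_le (ltW t23) t3D; have t1D := theta_dom_le (ltW t12) t2D.
pose g x := c * (f x)%:num.
have gE t : theta_dom f t ->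
    series (fun x => weight f t x * g x) @ \oo -->
    c * (expR t * moment (weight f t) (fun=> 1)).
  move=> tD; rewrite (_ : series _ = fun N =>
      c * series (fun x => weight f t x * (f x)%:num) N).
    by apply: cvgMl_tmp; exact: cvg_moment_rate.
  apply/funext => N; rewrite /series /= mulr_sumr; apply: eq_bigr => x _.
  by rewrite mulrCA.
have sg t : theta_dom f t -> has_moments (fun=> 1) (fun x => x%:R) g (weight f t).
  move=> tD; split; [exact: has_moment1|exact: has_moment_natr|].
  by apply/cvg_ex; eexists; exact: gE.
have mg t : theta_dom f t ->
    moment (weight f t) g = c * (expR t * moment (weight f t) (fun=> 1)).
  by move=> /gE/cvg_lim; exact.
have mn t : theta_dom f t -> moment (weight f t) (fun x => x%:R) =
    density f t * moment (weight f t) (fun=> 1).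
  by move=> tD; rewrite densityE // divfK // gt_eqF // moment1_gt0.
(* The column of t_i is Z_i times (1, density t_i, c exp t_i), so the three masses factor out. *)
have DE : moment_det3 (weight f t1) (weight f t2) (weight f t3)
    (fun=> 1) (fun x => x%:R) g =
  moment (weight f t1) (fun=> 1) * moment (weight f t2) (fun=> 1) *
  moment (weight f t3) (fun=> 1) * D.
  rewrite /moment_det3 !mg // !mn // /D.
  move: (moment (weight f t1) _) (moment (weight f t2) _)
    (moment (weight f t3) _) (density f t1) (density f t2) (density f t3).
  by move: (expR t1) (expR t2) (expR t3) => *; ring.
have Z0 : 0 < moment (weight f t1) (fun=> 1) * moment (weight f t2) (fun=> 1) *
  moment (weight f t3) (fun=> 1) by rewrite !mulr_gt0 ?moment1_gt0.
have det0 x y z : (x < y < z)%N ->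
  0 <= det3 (weight f t1) (weight f t2) (weight f t3) x y z *
       det3 (fun=> 1) (fun x => x%:R) g x y z.
  move=> xyz; rewrite mulr_ge0 ?convex_det3_ge0 //.
  by rewrite ltW // det3_weight_gt0.
split.
  by rewrite -(pmulr_rge0 _ Z0) -DE moment_det3_ge0 //; exact: sg.
move=> c0 fl; rewrite -(pmulr_rgt0 _ Z0) -DE.
have [|x Hx] := nonlinear_det3_gt0 cf.
  apply: contra_not fl => -[d dE]; exists (c^-1 * d) => x.
  by rewrite -(dE x) -mulrBr mulKf.
apply: (moment_det3_gt0 _ _ _ _ (x := x) (y := x.+1) (z := x.+2)) => //.
1-3: exact: sg.
by rewrite mulr_gt0 // det3_weight_gt0 // !ltnSn.
Qed.

Lemma flux_conv_lt (c s x y : R) :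
  nondecreasing_seq (fun x => c * (f x.+1)%:num - c * (f x)%:num) ->
  density_range f x -> density_range f y -> 0 < s < 1 -> x < y ->
  let D := c * (s * flux f x + (1 - s) * flux f y
    - flux f (s * x + (1 - s) * y)) in
  0 <= D /\ (c != 0 -> ~ linear_rate f -> 0 < D).
Proof.
move=> cf [t1 t1D <-] [t3 t3D <-] /andP[s0 s1] d13 D.
have t13 : t1 < t3.
  rewrite ltNge; apply/negP; rewrite le_eqVlt => /predU1P[E|t31].
    by move: d13; rewrite E ltxx.
  by have := lt_trans d13 (lt_density t1D t31); rewrite ltxx.
have [|t2 /andP[t12 t23] d2] :=
  @density_range_between t1 t3 (s * density f t1 + (1 - s) * density f t3) t3D t13.
  have h : 0 < density f t3 - density f t1 by rewrite subr_gt0.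
  have := mulr_gt0 s0 h; have := mulr_gt0 (_ : 0 < 1 - s) h.
  rewrite subr_gt0 => /(_ s1) ? ?; apply/andP; split; lra.
have t2D := theta_dom_le (ltW t23) t3D.
have := flux_chord cf t12 t23 t3D.
rewrite /D -d2 !flux_density //= d2 => -[].
(* At the middle density the two gaps are the fractions 1 - s and s of the whole gap, so the
   determinant is that gap times the convexity defect. *)
rewrite (_ : c * _ = (density f t3 - density f t1) *
  (c * (s * expR t1 + (1 - s) * expR t3 - expR t2))); last by ring.
have h : 0 < density f t3 - density f t1 by rewrite subr_gt0.
rewrite (pmulr_rge0 _ h) (pmulr_rgt0 _ h) => H1 H2.
exact: (conj H1 H2).
Qed.

Lemma flux_conv (c s x y : R) :
  nondecreasing_seq (fun x => c * (f x.+1)%:num - c * (f x)%:num) ->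
  density_range f x -> density_range f y -> 0 < s < 1 -> x != y ->
  let D := c * (s * flux f x + (1 - s) * flux f y
    - flux f (s * x + (1 - s) * y)) in
  0 <= D /\ (c != 0 -> ~ linear_rate f -> 0 < D).
Proof.
move=> cf xD yD s01; rewrite neq_lt => /orP[xy|yx].
  exact: flux_conv_lt.
have s01' : 0 < 1 - s < 1 by move: s01; lra.
have := flux_conv_lt cf yD xD s01' yx; rewrite subKr.
by rewrite (addrC ((1 - s) * flux f y)) (addrC ((1 - s) * y)).
Qed.

End zero_range_moments.

(** * Convexity, concavity and strictness of the flux *)

(** The sign of [c] is free: a linear rate is both convex and concave. *)
Lemma scaled_linear_rate (R : realType) (f : nat -> {nonneg R}) (c : R) :
  linear_rate f ->
  nondecreasing_seq (fun x => c * (f x.+1)%:num - c * (f x)%:num).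
Proof. by move=> [d dE] x y _ /=; rewrite -!mulrBr !dE. Qed.

Unset Implicit Arguments.

Theorem proposition3p1 (R : realType) (f : nat -> {nonneg R})
    (f_nd : nondecreasing_seq (fun x => (f x)%:num))
    (f0 : (f 0%N)%:num = 0) (f1 : 0 < (f 1%N)%:num)
    (f_bar : (0 < theta_bar f)%E) :
  [/\ convex_rate f -> convex_function (E := R^o) (density_range f) (flux f),
      concave_rate f -> concave_function (density_range f) (flux f),
      convex_rate f ->
        (strictly_convex_function (density_range f) (flux f) <->
         ~ linear_rate f) &
      concave_rate f ->
        (strictly_concave_function (density_range f) (flux f) <->
         ~ linear_rate f)].
Proof.
have cvx1 : convex_rate f ->
    nondecreasing_seq (fun x => 1 * (f x.+1)%:num - 1 * (f x)%:num).
  by move=> cf x y xy; rewrite !mul1r; exact: cf.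
have cvxN1 : concave_rate f ->
    nondecreasing_seq (fun x => -1 * (f x.+1)%:num - -1 * (f x)%:num).
  by move=> cf x y xy; have := cf _ _ xy; lra.
(* Endpoints and equal points, which [flux_conv] excludes, give equality. *)
have trivial_conv (t : {i01 R}) (x y : R^o) : ~~ (0 < t%:num < 1) \/ x = y ->
    flux f (conv t x y) = conv t (flux f x : R^o) (flux f y : R^o).
  move=> [t01|->]; last by rewrite !convmm.
  have [->|t0] := eqVneq t 0%:i01; first by rewrite !conv0.
  have [->|t1] := eqVneq t 1%:i01; first by rewrite !conv1.
  by move: t01; rewrite !lt_neqAle eq_sym t0 t1 ge0 le1.
have strict_conv c : c != 0 ->
    nondecreasing_seq (fun x => c * (f x.+1)%:num - c * (f x)%:num) ->
    ~ linear_rate f -> forall t : {i01 R}, 0 < t%:num < 1 ->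
    {in density_range f &, forall x y : R^o, x != y ->
      0 < c * (conv t (flux f x : R^o) (flux f y : R^o) - flux f (conv t x y))}.
  move=> c0 cf fl t t01 x y; rewrite !inE => xD yD xy.
  rewrite !convRE.
  by have [_] := flux_conv f_nd f0 f1 cf xD yD t01 xy; apply.
have weak_conv c :
    nondecreasing_seq (fun x => c * (f x.+1)%:num - c * (f x)%:num) ->
    forall t : {i01 R}, {in density_range f &, forall x y : R^o,
      0 <= c * (conv t (flux f x : R^o) (flux f y : R^o) - flux f (conv t x y))}.
  move=> cf t x y; rewrite !inE => xD yD.
  have [t01|t01] := boolP (0 < t%:num < 1); last first.
    by rewrite trivial_conv ?subrr ?mulr0 //; left.
  have [->|xy] := eqVneq x y.
    by rewrite trivial_conv ?subrr ?mulr0 //; right.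
  rewrite !convRE.
  by have [+ _] := flux_conv f_nd f0 f1 cf xD yD t01 xy; apply.
(* For linear [f] the weak inequalities with c = 1 and c = -1 give equality at the midpoint of two
   distinct densities, which rules out strictness. *)
have linear_conv : linear_rate f -> exists (t : {i01 R}) (x y : R^o),
    [/\ 0 < t%:num < 1, x \in density_range f, y \in density_range f, x != y &
      flux f (conv t x y) = conv t (flux f x : R^o) (flux f y : R^o)].
  move=> fl.
  (* Positivity of [theta_bar] puts 0, hence also -1, in the domain, so two distinct densities
     exist. *)
  have D0 : theta_dom f 0 by [].
  have DN1 : theta_dom f (-1) by apply: theta_dom_le D0; rewrite lerN10.
  have h0 : 0 <= (2^-1 : R) by rewrite invr_ge0.
  have h1 : (2^-1 : R) <= 1 by rewrite invf_le1 // ler1n.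
  have h01 : 0 < (Itv01 h0 h1)%:num < 1.
    by rewrite /= invr_gt0 invf_lt1 // ltr1n ltr0n.
  have xD : density f (-1) \in density_range f by rewrite inE; exists (-1).
  have yD : density f 0 \in density_range f by rewrite inE; exists 0.
  exists (Itv01 h0 h1), (density f (-1)), (density f 0); split => //.
    by rewrite lt_eqF // lt_density // ltrN10.
  have := weak_conv 1 (scaled_linear_rate 1 fl) (Itv01 h0 h1) _ _ xD yD.
  have := weak_conv (-1) (scaled_linear_rate (-1) fl) (Itv01 h0 h1) _ _ xD yD.
  by rewrite mulN1r mul1r oppr_ge0 subr_le0 subr_ge0 => ? ?; apply/le_anti/andP.
split.
- move=> /cvx1/weak_conv H t x y xD yD.
  by have := H t x y xD yD; rewrite mul1r subr_ge0.
- move=> /cvxN1/weak_conv H t x y xD yD.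
  by have := H t x y xD yD; rewrite mulN1r opprB subr_ge0.
- move=> cf; split=> [H /linear_conv[t [x [y [t01 xD yD xy E]]]]|].
    by have := H t t01 x y xD yD xy; rewrite E ltxx.
  move=> fl t t01 x y xD yD xy.
  have := strict_conv 1 (oner_neq0 _) (cvx1 cf) fl t t01 x y xD yD xy.
  by rewrite mul1r subr_gt0.
- move=> cf; split=> [H /linear_conv[t [x [y [t01 xD yD xy E]]]]|].
    by have := H t t01 x y xD yD xy; rewrite E ltxx.
  move=> fl t t01 x y xD yD xy.
  have := strict_conv (-1) _ (cvxN1 cf) fl t t01 x y xD yD xy.
  by rewrite mulN1r opprB subr_gt0; apply; rewrite oppr_eq0 oner_eq0.
Qed.
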